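(* Let $\gamma\in\mathcal{D}(\mathbf{2}\times\mathbf{2})$ and $K,L\in\mathbb{N}$. Bivariate binomials are closed under convolution: $$\mathrm{bvbn}[K](\gamma)+\mathrm{bvbn}[L](\gamma)=\mathrm{bvbn}[K+L](\gamma).$$ Moreover, the bivariate binomial is a $K$-fold convolution of $\gamma$: $$\mathrm{bvbn}[K](\gamma)=K\cdot\gamma=\underbrace{\gamma+\cdots+\gamma}_{K\text{ times}}.$$ Here $+$ between distributions denotes convolution of distributions on the monoid $\mathbb{N}^2$.
   Context: $\mathbf{2}=\{0,1\}$. For a set $X$, $\mathcal{D}(X)$ is the set of finitely supported probability distributions on $X$, i.e. functions $\omega\colon X\to[0,1]$ with finite support and $\sum_x\omega(x)=1$. For $f\colon X\to Y$, $\mathcal{D}(f)\colon\mathcal{D}(X)\to\mathcal{D}(Y)$ is the pushforward $\mathcal{D}(f)(\omega)(y)=\sum_{x\in f^{-1}(y)}\omega(x)$. Convolution: for a commutative monoid $(M,+,0)$ and $\omega,\rho\in\mathcal{D}(M)$, the convolution $\omega+\rho\in\mathcal{D}(M)$ is $(\omega+\rho)(z)=\sum_{x,y\in M,\,x+y=z}\omega(x)\rho(y)$. This makes $\mathcal{D}(M)$ a commutative monoid whose unit is the point distribution at $0$; $K\cdot\omega$ denotes the $K$-fold sum in this monoid (with $0\cdot\omega$ the unit). The monoid used is $\mathbb{N}^2=\mathbb{N}\times\mathbb{N}$ with component-wise addition; distributions on $\mathbf{2}\times\mathbf{2}$ and on $\{0,\ldots,K\}\times\{0,\ldots,K\}$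 are regarded as distributions on $\mathbb{N}^2$ via inclusion. $\mathcal{M}[K](X)$ is the set of multisets over $X$ of size $K$, i.e. finitely supported functions $\varphi\colon X\to\mathbb{N}$ with $\sum_x\varphi(x)=K$. For $\omega\in\mathcal{D}(X)$ with $X$ finite, the multinomial distribution $\mathrm{mn}[K](\omega)\in\mathcal{D}(\mathcal{M}[K](X))$ is $$\mathrm{mn}[K](\omega)(\varphi)=\frac{K!}{\prod_x\varphi(x)!}\prod_{x\in X}\omega(x)^{\varphi(x)}\qquad(0^0=1).$$ The marginal heads function $\mathrm{heads}\colon\mathcal{M}[K](\mathbf{2}\times\mathbf{2})\to\{0,\ldots,K\}\times\{0,\ldots,K\}$ is $\mathrm{heads}(\varphi)=\big(\varphi(1,0)+\varphi(1,1),\ \varphi(0,1)+\varphi(1,1)\big)$. The bivariate binomial distribution of $\gamma\in\mathcal{D}(\mathbf{2}\times\mathbf{2})$ with $K$ tosses is $$\mathrm{bvbn}[K](\gamma)=\mathcal{D}(\mathrm{heads})\big(\mathrm{mn}[K](\gamma)\big)\in\mathcal{D}\big(\{0,\ldots,K\}\times\{0,\ldots,K\}\big).$$ *)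

(* Defs.v *)
From HB Require Import structures.
From mathcomp Require Import all_boot all_order all_algebra.
From mathcomp Require Import finmap multiset reals ring.

Set Implicit Arguments.
Unset Strict Implicit.
Unset Printing Implicit Defensive.

Import Order.TTheory GRing.Theory Num.Theory.

Local Open Scope mset_scope.
Local Open Scope fset_scope.
Local Open Scope ring_scope.

Section Weights.
Variables (R : realType) (X : choiceType).
Implicit Types (p q : {fsfun X -> R with 0}) (g : X -> R).

(* Outside the finite support the value is 0, so it is enough to bound the
   values on the support. *)
Definition is_dist p :=
  [forall x : finsupp p, 0 <= p (val x) <= 1]
  && (\sum_(x <- finsupp p) p x == 1).

(* For a distribution p this is the expectation of g. *)
Definition wsum p g : R := \sum_(x <- finsupp p) p x * g x.

Lemma wsum_fsfun (S : {fset X}) (h : X -> R) g :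
  wsum [fsfun x in S => h x] g = \sum_(x <- S) h x * g x.
Proof.
rewrite /wsum; set p := [fsfun x in S => h x].
have sub : finsupp p `<=` S by exact: finsupp_sub.
rewrite (big_fset_incl _ sub) => [|x xS xp]; last first.
  by rewrite fsfun_dflt // mul0r.
rewrite big_seq [RHS]big_seq; apply: eq_bigr => x xS.
by rewrite fsfunE xS.
Qed.

Lemma wsum1 p : wsum p (fun=> 1) = \sum_(x <- finsupp p) p x.
Proof. by apply: eq_bigr => x _; rewrite mulr1. Qed.

Lemma wsum_delta p y : wsum p (fun x => (x == y)%:R) = p y.
Proof.
rewrite /wsum; case: (finsuppP p y) => [yp|yp].
  rewrite big_seq big1 // => x xp; case: eqP => [xy|_]; last by rewrite mulr0.
  by rewrite -xy xp in yp.
rewrite (big_fsetD1 y) //= eqxx mulr1 big_seq big1 ?addr0 // => x.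
by rewrite !inE => /andP[/negPf-> _]; rewrite mulr0.
Qed.

Lemma wsum_ext p q : (forall g, wsum p g = wsum q g) -> p = q.
Proof.
by move=> pq; apply/fsfunP => x; rewrite -!wsum_delta pq.
Qed.

Lemma is_distP p : (forall x, 0 <= p x) -> wsum p (fun=> 1) = 1 -> is_dist p.
Proof.
move=> p0; rewrite wsum1 => p1; rewrite /is_dist p1 eqxx andbT.
apply/forallP => x; rewrite p0 /= -p1 (big_fsetD1 (val x)) ?valP //=.
by rewrite lerDl sumr_ge0.
Qed.

End Weights.

Record dist (R : realType) (X : choiceType) := Dist {
  dist_fun :> {fsfun X -> R with 0};
  _ : is_dist dist_fun
}.

HB.instance Definition _ (R : realType) (X : choiceType) :=
  [isSub for @dist_fun R X].
HB.instance Definition _ (R : realType) (X : choiceType) :=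
  [Choice of dist R X by <:].

Section DistTheory.
Variables (R : realType) (X : choiceType).
Implicit Types (w : dist R X).

Lemma dist_ge0 w x : 0 <= w x.
Proof.
case: w => p /= /andP[/forallP pP _]; case: (finsuppP p x) => // xp.
by have /andP[] := pP [` xp].
Qed.

Lemma dist_wsum1 w : wsum w (fun=> 1) = 1.
Proof. by rewrite wsum1; case: w => p /= /andP[_ /eqP]. Qed.

Lemma dist_ext w1 w2 : (forall g, wsum w1 g = wsum w2 g) -> w1 = w2.
Proof. by move=> w12; apply/val_inj/wsum_ext. Qed.

End DistTheory.

Section Dirac.
Variables (R : realType) (X : choiceType) (a : X).

Definition dirac_fun : {fsfun X -> R with 0} := [fsfun x in [fset a] => 1].

Lemma wsum_dirac g : wsum dirac_fun g = g a.
Proof. by rewrite wsum_fsfun big_seq_fset1 mul1r. Qed.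

Fact dirac_subproof : is_dist dirac_fun.
Proof.
apply: is_distP => [x|]; last by rewrite wsum_dirac.
by rewrite fsfunE; case: ifP.
Qed.

Definition dirac : dist R X := Dist dirac_subproof.

End Dirac.

Section Pushforward.
Variables (R : realType) (X Y : choiceType) (f : X -> Y) (w : dist R X).

Definition dmap_fun : {fsfun Y -> R with 0} :=
  [fsfun y in [fset f x | x in finsupp w] =>
     \sum_(x <- finsupp w | f x == y) w x].

Lemma wsum_dmap g : wsum dmap_fun g = wsum w (g \o f).
Proof.
rewrite wsum_fsfun /wsum [RHS](partition_big_imfset _ f) /=.
apply: eq_bigr => y _; rewrite mulr_suml.
by apply: eq_bigr => x /eqP ->.
Qed.

Fact dmap_subproof : is_dist dmap_fun.
Proof.
apply: is_distP => [y|]; last by rewrite wsum_dmap dist_wsum1.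
rewrite fsfunE; case: ifP => // _; apply: sumr_ge0 => x _; exact: dist_ge0.
Qed.

Definition dmap : dist R Y := Dist dmap_subproof.

End Pushforward.

Section Convolution.
Variables (R : realType) (M : nmodType).
Implicit Types (w r : dist R M).

Definition conv_fun w r : {fsfun M -> R with 0} :=
  [fsfun z in [fset x + y | x in finsupp w, y in finsupp r] =>
     \sum_(x <- finsupp w) \sum_(y <- finsupp r | x + y == z) w x * r y].

Lemma wsum_conv w r g :
  wsum (conv_fun w r) g = wsum w (fun x => wsum r (fun y => g (x + y))).
Proof.
rewrite wsum_fsfun; under eq_bigr do rewrite mulr_suml.
rewrite exchange_big /= /wsum big_seq [RHS]big_seq.
apply: eq_bigr => x xw; rewrite mulr_sumr.
under eq_bigr => z _ do rewrite mulr_suml big_mkcond /=.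
rewrite exchange_big /= big_seq [RHS]big_seq; apply: eq_bigr => y yr.
rewrite (big_fsetD1 (x + y)) /=; last by apply/imfset2P; exists x => //; exists y.
rewrite eqxx -mulrA big_seq big1 ?addr0 // => z.
by rewrite !inE eq_sym => /andP[/negPf-> _].
Qed.

Fact conv_subproof w r : is_dist (conv_fun w r).
Proof.
apply: is_distP => [z|]; last first.
  by rewrite wsum_conv; under [wsum w _]eq_bigr do rewrite dist_wsum1;
    exact: dist_wsum1.
rewrite fsfunE; case: ifP => // _; apply: sumr_ge0 => x _.
by apply: sumr_ge0 => y _; rewrite mulr_ge0 ?dist_ge0.
Qed.

Definition conv w r : dist R M := Dist (conv_subproof w r).

Lemma convA : associative conv.
Proof.
move=> w r s; apply: dist_ext => g; rewrite !wsum_conv.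
apply: eq_bigr => x _; rewrite !wsum_conv; congr (_ * _).
apply: eq_bigr => y _; congr (_ * _).
by apply: eq_bigr => z _; rewrite addrA.
Qed.

Lemma convC : commutative conv.
Proof.
move=> w r; apply: dist_ext => g; rewrite !wsum_conv /wsum.
under eq_bigr do rewrite mulr_sumr; rewrite exchange_big /=.
apply: eq_bigr => y _; rewrite mulr_sumr; apply: eq_bigr => x _.
by rewrite mulrCA addrC.
Qed.

Lemma conv0 : left_id (dirac R 0) conv.
Proof.
move=> w; apply: dist_ext => g; rewrite wsum_conv wsum_dirac.
by apply: eq_bigr => x _; rewrite add0r.
Qed.

HB.instance Definition _ := GRing.isNmodule.Build (dist R M) convA convC conv0.

End Convolution.

(* Needed for an element of kmset below to be applicable as a function. *)
Identity Coercion multiset_fsfun : multiset >-> fsfun.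

(* The size of a {mset X} is the sum of its multiplicities, by size_mset. *)
Record kmset (X : choiceType) (K : nat) := KMset {
  mset_of_kmset :> {mset X};
  _ : size mset_of_kmset == K
}.

HB.instance Definition _ (X : choiceType) (K : nat) :=
  [isSub for @mset_of_kmset X K].
HB.instance Definition _ (X : choiceType) (K : nat) :=
  [Choice of kmset X K by <:].

HB.instance Definition _ (X : countType) (K : nat) :=
  [Countable of kmset X K by <:].

Section KMsetFinite.
Variables (X : finType) (K : nat).
Implicit Types (phi : kmset X K).

Lemma size_mset_sum (A : {mset X}) : size A = (\sum_x A x)%N.
Proof.
rewrite size_mset [RHS](bigID (mem (finsupp A))) /= [X in (_ + X)%N]big1 ?addn0.
  rewrite -[RHS]big_filter; apply: perm_big; apply: uniq_perm => //.
  - exact: fset_uniq.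
  - by rewrite filter_uniq ?index_enum_uniq.
  - by move=> x; rewrite mem_filter mem_index_enum andbT.
by move=> x; exact: fsfun_dflt.
Qed.

Lemma kmset_sum phi : (\sum_x phi x)%N = K.
Proof. by rewrite -size_mset_sum; apply/eqP; case: phi. Qed.

Lemma kmset_lt phi x : (phi x < K.+1)%N.
Proof. by rewrite ltnS -[leqRHS](kmset_sum phi) (bigD1 x) //= leq_addr. Qed.

Definition kmset_enc phi : {ffun X -> 'I_K.+1} :=
  [ffun x => Ordinal (kmset_lt phi x)].
Definition kmset_dec (h : {ffun X -> 'I_K.+1}) : option (kmset X K) :=
  insub ([fsfun x in [fset x | x in X] => h x : nat] : {mset X}).

Lemma kmset_encK : pcancel kmset_enc kmset_dec.
Proof.
move=> phi; rewrite /kmset_dec.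
suff -> : [fsfun x in [fset x | x in X] => kmset_enc phi x : nat]
  = mset_of_kmset phi by rewrite valK.
by apply/msetP => x; rewrite fsfunE ffunE /= !inE.
Qed.

HB.instance Definition _ : isFinite (kmset X K) := PCanIsFinite kmset_encK.

End KMsetFinite.

Section Multinomial.
Variables (R : realType) (X : finType).
Implicit Types (w : dist R X).

Definition mn_weight w (K : nat) (A : {mset X}) : R :=
  (K`!)%:R / (\prod_x (A x)`!)%:R * \prod_x w x ^+ A x.

Definition mn_fun K w : {fsfun kmset X K -> R with 0} :=
  [fsfun phi in [fset phi : kmset X K | true] => mn_weight w K phi].

Lemma mn_weight_ge0 w K A : 0 <= mn_weight w K A.
Proof.
rewrite /mn_weight mulr_ge0 ?divr_ge0 ?ler0n //.
by apply: prodr_ge0 => x _; rewrite exprn_ge0 ?dist_ge0.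
Qed.

(* Drawing one element x more, after a draw B of K elements. *)
Lemma mn_weight_add1 w K (B : {mset X}) x :
  mn_weight w K.+1 (x +` B) * (B x).+1%:R
  = K.+1%:R * (w x * mn_weight w K B).
Proof.
rewrite /mn_weight (bigD1 x) //= [\prod_i w i ^+ _](bigD1 x) //=.
rewrite [in RHS](bigD1 x) //= [in RHS](bigD1 (F := fun i => w i ^+ B i) x) //=.
rewrite !mset1DE eqxx add1n.
under eq_bigr => i /negPf ix do rewrite mset1DE ix add0n.
under [\prod_(i | i != x) w i ^+ (x +` B)%mset i]eq_bigr => i /negPf ix
  do rewrite mset1DE ix add0n.
set P := (\prod_(i | i != x) (B i)`!)%N.
have P0 : P%:R != 0 :> R.
  by rewrite pnatr_eq0 -lt0n prodn_gt0 // => i; exact: fact_gt0.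
have F0 n : n`!%:R != 0 :> R by rewrite pnatr_eq0 -lt0n fact_gt0.
rewrite !factS !natrM exprS; field.
by rewrite P0 F0 nat1r pnatr_eq0.
Qed.

Lemma kmset_add1_subproof K (B : kmset X K) x : size (x +` B)%mset == K.+1.
Proof.
rewrite size_mset_sum; under eq_bigr do rewrite mset1DE.
by rewrite big_split /= kmset_sum (bigD1 x) //= eqxx big1 // => i /negPf->.
Qed.

Definition kmset_add1 K (B : kmset X K) x : kmset X K.+1 :=
  KMset (kmset_add1_subproof B x).

Lemma kmset_sub1_subproof K (A : kmset X K.+1) x :
  (0 < A x)%N -> size (A `\ x)%mset == K.
Proof.
move=> Ax; rewrite size_mset_sum; apply/eqP; apply: succn_inj.
rewrite -[RHS](kmset_sum A) (bigD1 x) //= [in RHS](bigD1 x) //= msetB1E eqxx.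
rewrite -addSn subn1 prednK //; congr (_ + _)%N.
by apply: eq_bigr => i /negPf ix; rewrite msetB1E ix subn0.
Qed.

Lemma mn_weight_sum w K : \sum_(A : kmset X K) mn_weight w K A = 1.
Proof.
elim: K => [|K IH].
  have s0 : size (mset0 : {mset X}) == 0%N by rewrite enum_mset0.
  rewrite (big_pred1 (KMset s0)) => [|A]; last first.
    apply/esym/eqP/val_inj/msetP => x /=; rewrite mset0E.
    by apply/eqP; rewrite -leqn0 -ltnS kmset_lt.
  rewrite /mn_weight /= fact0 !big1 ?divr1 ?mulr1 // => x _;
  by rewrite mset0E ?fact0.
have K0 : K.+1%:R != 0 :> R by rewrite pnatr_eq0.
apply: (mulfI K0); rewrite mulr1 mulr_sumr.
transitivity (\sum_(A : kmset X K.+1) \sum_(x | (0 < A x)%N)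
                 (A x)%:R * mn_weight w K.+1 A).
  apply: eq_bigr => A _; rewrite -mulr_suml -natr_sum; congr (_%:R * _).
  rewrite -[LHS](kmset_sum A) [RHS]big_mkcond /=; apply: eq_bigr => x _.
  by case: (A x).
rewrite (exchange_big_dep xpredT) //=.
transitivity (\sum_x \sum_(B : kmset X K) K.+1%:R * (w x * mn_weight w K B)).
  apply: eq_bigr => x _.
  have sx : size (msetn K x) == K by rewrite enum_msetn size_nseq.
  rewrite (reindex_onto (fun B : kmset X K => kmset_add1 B x)
     (fun A => insubd (KMset sx) (A `\ x)%mset)) /=; last first.
    move=> A Ax; apply/val_inj; rewrite /= val_insubd kmset_sub1_subproof //.
    apply/msetP => i; rewrite mset1DE msetB1E.
    by case: eqVneq => [->|] //=; rewrite ?subnKC ?subn0.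
  apply: eq_big => [B|B _].
    rewrite mset1DE eqxx; apply/eqP/val_inj; rewrite val_insubd.
    have -> : ((x +` B) `\ x)%mset = B :> {mset X}.
      by apply/msetP => i; rewrite msetB1E mset1DE addKn.
    by case: B => B /= ->.
  by rewrite mset1DE eqxx add1n mulrC mn_weight_add1.
under eq_bigr do rewrite -mulr_sumr -mulr_sumr IH mulr1.
rewrite -mulr_sumr -[RHS]mulr1 -(dist_wsum1 w) wsum1; congr (_ * _).
rewrite [LHS](bigID (mem (finsupp w))) /= [X in _ + X]big1 ?addr0; last first.
  by move=> x; exact: fsfun_dflt.
rewrite -[LHS]big_filter; apply: perm_big; apply: uniq_perm.
- by rewrite filter_uniq ?index_enum_uniq.
- exact: fset_uniq.
- by move=> x; rewrite mem_filter mem_index_enum andbT.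
Qed.

Fact mn_subproof K w : is_dist (mn_fun K w).
Proof.
apply: is_distP => [A|].
  by rewrite fsfunE; case: ifP => // _; exact: mn_weight_ge0.
rewrite wsum_fsfun; under eq_bigr do rewrite mulr1.
rewrite -[RHS](mn_weight_sum w K); apply: perm_big; apply: uniq_perm.
- exact: fset_uniq.
- exact: index_enum_uniq.
- by move=> A; rewrite mem_index_enum !inE.
Qed.

Definition mn K w : dist R (kmset X K) := Dist (mn_subproof K w).

End Multinomial.

Fact heads1_subproof K (phi : kmset (bool * bool)%type K) :
  (phi (true, false) + phi (true, true) < K.+1)%N.
Proof.
rewrite ltnS -[leqRHS](kmset_sum phi) (bigD1 (true, true)) //=.
by rewrite (bigD1 (true, false)) //= addnA [leqLHS]addnC leq_addr.
Qed.

Fact heads2_subproof K (phi : kmset (bool * bool)%type K) :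
  (phi (false, true) + phi (true, true) < K.+1)%N.
Proof.
rewrite ltnS -[leqRHS](kmset_sum phi) (bigD1 (true, true)) //=.
by rewrite (bigD1 (false, true)) //= addnA [leqLHS]addnC leq_addr.
Qed.

(* The set 2 = {0,1} is bool, with true standing for 1. *)
Definition heads K (phi : kmset (bool * bool)%type K) : 'I_K.+1 * 'I_K.+1 :=
  (Ordinal (heads1_subproof phi), Ordinal (heads2_subproof phi)).

Definition bvbn (R : realType) K (gamma : dist R (bool * bool)%type) :
  dist R ('I_K.+1 * 'I_K.+1)%type := dmap (@heads K) (mn K gamma).

Definition incl_ord (R : realType) n (w : dist R ('I_n * 'I_n)%type) :
    dist R (nat * nat)%type :=
  dmap (fun p : 'I_n * 'I_n => (p.1 : nat, p.2 : nat)) w.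

Definition incl_bool (R : realType) (w : dist R (bool * bool)%type) :
    dist R (nat * nat)%type :=
  dmap (fun p : bool * bool => (p.1 : nat, p.2 : nat)) w.

(* Main.v *)
Require Import Defs.
From mathcomp Require Import all_boot all_order all_algebra.
From mathcomp Require Import finmap multiset reals.

Import GRing.Theory.
Local Open Scope mset_scope.
Local Open Scope ring_scope.

(** A multinomial draw of size [K.+1] is one draw from [w] followed by an
    independent multinomial draw of size [K].  On weights this is a Pascal rule
    ([mn_weight_pascal]); on expectations it is [wsum_mnS].  The two head counts
    of a multiset are additive, so pushing this recursion forward along them
    gives bvbn[K+1](gamma) = gamma + bvbn[K](gamma), the sum being convolution
    on pairs of naturals ([bvbnS]).  Together with the case of zero tosses, this
    makes bvbn[K](gamma) the [K]-th multiple of gamma in the commutative monoid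
    of distributions.  Closure under convolution is then the law
    K.gamma + L.gamma = (K + L).gamma of that monoid.

    Equalities of distributions are checked on expectations [wsum _ g] for all
    [g], on which pushforward is precomposition and convolution is an iterated
    expectation. *)

Section MultinomialRecursion.
Variables (R : realType) (X : finType).
Implicit Types (w : dist R X).

Lemma wsum_fin w (g : X -> R) : wsum w g = \sum_x w x * g x.
Proof.
rewrite /wsum [RHS](bigID (mem (finsupp w))) /= [X in _ + X]big1 ?addr0.
  rewrite -[RHS]big_filter; apply: perm_big; apply: uniq_perm.
  - exact: fset_uniq.
  - by rewrite filter_uniq ?index_enum_uniq.
  - by move=> x; rewrite mem_filter mem_index_enum andbT.
by move=> x xw; rewrite fsfun_dflt ?mul0r.
Qed.

(** Condition on the type [x] of the last element drawn: the share of the draws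
    of [A] ending in [x] is [A x / K.+1], by [mn_weight_add1], and these shares
    add up to 1. *)
Lemma mn_weight_pascal w K (A : kmset X K.+1) :
  mn_weight w K.+1 A =
  \sum_(x | (0 < A x)%N) w x * mn_weight w K (A `\ x)%mset.
Proof.
have K0 : K.+1%:R != 0 :> R by rewrite Num.Theory.pnatr_eq0.
apply: (mulfI K0); rewrite mulr_sumr.
rewrite -{1}(kmset_sum A) natr_sum mulr_suml.
rewrite [RHS]big_mkcond /=; apply: eq_bigr => x _.
case: ltnP => [Ax|]; last by rewrite leqn0 => /eqP->; rewrite mul0r.
rewrite -mn_weight_add1 msetB1E eqxx subn1 prednK // mulrC.
congr (mn_weight _ _ _ * _); apply/msetP => i; rewrite mset1DE msetB1E.
by case: eqVneq => [->|_] /=; rewrite ?subnKC // subn0.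
Qed.

(** Adding [x] is a bijection from the multisets of size [K] onto the multisets
    of size [K.+1] that contain [x]. *)
Lemma sum_kmset_add1 K (x : X) (F : {mset X} -> R) :
  \sum_(A : kmset X K.+1 | (0 < A x)%N) F A =
  \sum_(B : kmset X K) F (x +` B)%mset.
Proof.
(* A default value for the inverse, which is taken only where [x] occurs. *)
have sx : size (msetn K x) == K by rewrite enum_msetn size_nseq.
rewrite (reindex_onto (fun B : kmset X K => kmset_add1 B x)
   (fun A => insubd (KMset sx) (A `\ x)%mset)) /=; last first.
  move=> A Ax; apply/val_inj; rewrite /= val_insubd kmset_sub1_subproof //.
  apply/msetP => i; rewrite mset1DE msetB1E.
  by case: eqVneq => [->|_] /=; rewrite ?subnKC // subn0.
apply: eq_bigl => B; rewrite mset1DE eqxx; apply/eqP/val_inj.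
have addK : ((x +` B) `\ x)%mset = B :> {mset X}.
  by apply/msetP => i; rewrite msetB1E mset1DE addKn.
by rewrite addK valKd.
Qed.

Lemma wsum_mn w K (g : {mset X} -> R) :
  wsum (mn K w) (fun A => g A) = \sum_(A : kmset X K) mn_weight w K A * g A.
Proof.
rewrite wsum_fsfun; apply: perm_big; apply: uniq_perm.
- exact: fset_uniq.
- exact: index_enum_uniq.
- by move=> A; rewrite mem_index_enum !inE.
Qed.

Lemma wsum_mn0 w (g : {mset X} -> R) :
  wsum (mn 0 w) (fun A => g A) = g mset0.
Proof.
have A0 (A : kmset X 0) : A = mset0 :> {mset X}.
  apply/msetP => x; rewrite mset0E.
  by apply/eqP; rewrite -leqn0 -ltnS kmset_lt.
rewrite wsum_mn (eq_bigr (fun A : kmset X 0 => mn_weight w 0 A * g mset0)).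
  by rewrite -mulr_suml mn_weight_sum mul1r.
by move=> A _; rewrite {2}A0.
Qed.

Lemma wsum_mnS w K (g : {mset X} -> R) :
  wsum (mn K.+1 w) (fun A => g A) =
  wsum w (fun x => wsum (mn K w) (fun B => g (x +` B)%mset)).
Proof.
rewrite wsum_mn wsum_fin.
under eq_bigr => A _ do rewrite mn_weight_pascal mulr_suml.
rewrite (exchange_big_dep xpredT) //=; apply: eq_bigr => x _.
rewrite (sum_kmset_add1 _ _
  (fun A => w x * mn_weight w K (A `\ x)%mset * g A)).
rewrite (wsum_mn _ _ (fun B => g (x +` B)%mset)) mulr_sumr.
apply: eq_bigr => B _; rewrite -mulrA; congr (_ * (mn_weight _ _ _ * _)).
by apply/msetP => i; rewrite msetB1E mset1DE addKn.
Qed.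

End MultinomialRecursion.

(** [heads] before restriction to a size: valued in the monoid of pairs of
    naturals, it is additive and comparable across all sizes. *)
Definition head_counts (A : {mset (bool * bool)%type}) : (nat * nat)%type :=
  ((A (true, false) + A (true, true))%N,
   (A (false, true) + A (true, true))%N).

Lemma head_counts0 : head_counts mset0 = 0.
Proof. by rewrite /head_counts !mset0E. Qed.

Lemma head_counts_add1 (x : (bool * bool)%type) (A : {mset (bool * bool)%type}) :
  head_counts (x +` A)%mset = (x.1 : nat, x.2 : nat) + head_counts A.
Proof.
case: x => [] [] []; rewrite /head_counts !mset1DE /= /GRing.add /=;
  by rewrite ?add0n ?add1n ?addnS.
Qed.

Section BivariateBinomial.
Variables (R : realType) (gamma : dist R (bool * bool)%type).

Lemma wsum_bvbn K (g : nat * nat -> R) :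
  wsum (incl_ord (bvbn K gamma)) g =
  wsum (mn K gamma) (fun A => g (head_counts A)).
Proof. by rewrite !wsum_dmap. Qed.

Lemma bvbn0 : incl_ord (bvbn 0 gamma) = 0.
Proof.
apply: dist_ext => g; rewrite wsum_bvbn wsum_dirac.
by rewrite (wsum_mn0 _ _ _ (g \o head_counts)) /= head_counts0.
Qed.

Lemma bvbnS K :
  incl_ord (bvbn K.+1 gamma) = incl_bool gamma + incl_ord (bvbn K gamma).
Proof.
apply: dist_ext => g; rewrite wsum_bvbn wsum_conv wsum_dmap.
rewrite (wsum_mnS _ _ _ _ (g \o head_counts)).
apply: eq_bigr => x _; congr (_ * _); rewrite /comp /= wsum_bvbn.
by apply: eq_bigr => A _; rewrite head_counts_add1.
Qed.

Lemma bvbn_mulrn K : incl_ord (bvbn K gamma) = incl_bool gamma *+ K.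
Proof.
by elim: K => [|K IH]; rewrite ?bvbn0 ?mulr0n // bvbnS IH mulrS.
Qed.

End BivariateBinomial.

Theorem proposition3p7 (R : realType) (gamma : dist R (bool * bool)%type)
    (K L : nat) :
  incl_ord (bvbn K gamma) + incl_ord (bvbn L gamma)
    = incl_ord (bvbn (K + L)%N gamma)
  /\ incl_ord (bvbn K gamma) = incl_bool gamma *+ K.
Proof. by split; rewrite !bvbn_mulrn // mulrnDr. Qed.
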